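(* Let $n\ge 3$ and let $f:\mathbb{R}\to(0,\infty)$ be a smooth function. Then the Egorov space $(\mathbb{R}^n,g_f)$ is of recurrent curvature; that is, at every point $p$ and for every $X\in T_p\mathbb{R}^n$, the tensors $(\nabla_XR)_p$ and $R_p$ are linearly dependent.
   Context: Egorov space: for $n\ge 3$ and a positive smooth function $f$ of one real variable, it is the Lorentzian manifold $(\mathbb{R}^n,g_f)$ with coordinates $(x_1,\dots,x_n)$ and metric $g_f=f(x_n)\sum_{i=1}^{n-2}(dx_i)^2+2\,dx_{n-1}dx_n$ (symmetric product, so $g_f(\partial_{n-1},\partial_n)=1$, $g_f(\partial_i,\partial_i)=f(x_n)$ for $i\le n-2$, all other components zero). $\nabla$ is the Levi-Civita connection and $R$ the curvature tensor. A pseudo-Riemannian manifold is said to be of recurrent curvature if the covariant derivative of its curvature tensor is linearly dependent on the curvature tensor itself, in the pointwise sense made explicit in the claim. *)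

(* Defs.v *)
From HB Require Import structures.
From mathcomp Require Import all_boot all_order all_algebra.
From mathcomp Require Import all_classical all_reals all_analysis.
Import Order.TTheory GRing.Theory Num.Theory.
Import numFieldNormedType.Exports.

Set Implicit Arguments.
Unset Strict Implicit.
Unset Printing Implicit Defensive.

Local Open Scope ring_scope.

Definition smooth (R : realType) (f : R -> R) : Prop :=
  forall (k : nat) (t : R), derivable (derive1n k f) t 1.

(* R^n is 'rV[R]_n, and every tangent space T_p R^n is identified with
   'rV[R]_n through the coordinate frame, so a vector field is a map
   'rV[R]_n -> 'rV[R]_n and a (1,3) tensor at a point is a map taking three
   tangent vectors to a tangent vector. A pseudo-Riemannian metric is given by
   the matrix of its components. *)
Section PseudoRiemannian.
Context (R : realType) (n : nat).
Local Notation vec := 'rV[R]_n.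

Definition vfield := vec -> vec.
Definition tensor13 := vec -> vec -> vec -> vec.

Definition partial (i : 'I_n) (F : vec -> R) (p : vec) : R :=
  'D_(delta_mx 0 i) F p.

Variable g : vec -> 'M[R]_n.

(* Gamma^k_ij = 1/2 sum_l g^kl (d_i g_jl + d_j g_il - d_l g_ij): the symbols of
   the Levi-Civita connection of g *)
Definition christoffel (k i j : 'I_n) (p : vec) : R :=
  2^-1 * \sum_(l < n) invmx (g p) k l *
    (partial i (fun q => g q j l) p + partial j (fun q => g q i l) p
     - partial l (fun q => g q i j) p).

(* nabla_v Y at p, for a tangent vector v at p *)
Definition covder (v : vec) (Y : vfield) (p : vec) : vec :=
  'D_v Y p +
  \row_(k < n) \sum_(i < n) \sum_(j < n)
    christoffel k i j p * v 0 i * Y p 0 j.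

Definition nabla (X Y : vfield) : vfield := fun p => covder (X p) Y p.

Definition lie_bracket (X Y : vfield) : vfield :=
  fun p => 'D_(X p) Y p - 'D_(Y p) X p.

Definition curvature_op (X Y Z : vfield) : vfield := fun p =>
  nabla X (nabla Y Z) p - nabla Y (nabla X Z) p - nabla (lie_bracket X Y) Z p.

(* R_p(u, v)w; by tensoriality the extension of u, v, w to vector fields is
   immaterial, and the one with constant components is used *)
Definition curvature (p : vec) : tensor13 := fun u v w =>
  curvature_op (fun=> u) (fun=> v) (fun=> w) p.

(* (nabla_x T)_p for a (1,3) tensor field T, by the Leibniz rule
   (nabla_x T)(U,V,W) = nabla_x (T(U,V,W)) - T(nabla_x U,V,W)
     - T(U,nabla_x V,W) - T(U,V,nabla_x W),
   again with the fields of constant components extending u, v, w *)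
Definition covder_tensor (T : vec -> tensor13) (x p : vec) : tensor13 :=
  fun u v w =>
    covder x (fun q => T q u v w) p
    - T p (covder x (fun=> u) p) v w
    - T p u (covder x (fun=> v) p) w
    - T p u v (covder x (fun=> w) p).

Definition linearly_dependent (S T : tensor13) : Prop :=
  exists a b : R, ~ (a = 0 /\ b = 0) /\
    forall u v w : vec, a *: S u v w + b *: T u v w = 0.

Definition recurrent_curvature : Prop :=
  forall p x : vec,
    linearly_dependent (covder_tensor curvature x p) (curvature p).

End PseudoRiemannian.

Fact last_index_subproof (n : nat) : (3 <= n)%N -> (n.-1 < n)%N.
Proof. by case: n. Qed.

Definition last_index (n : nat) (hn : (3 <= n)%N) : 'I_n :=
  Ordinal (last_index_subproof hn).

(* Indices start at 0: x_1, ..., x_(n-2) have indices i < n - 2, while x_(n-1)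
   and x_n have indices n - 2 and n - 1. The symmetric product
   2 dx_(n-1) dx_n contributes an entry 1 at each of the two off-diagonal
   positions. *)
Definition egorov_metric (R : realType) (n : nat) (hn : (3 <= n)%N)
    (f : R -> R) (p : 'rV[R]_n) : 'M[R]_n :=
  \matrix_(i < n, j < n)
    if (i == j) && (i < n - 2)%N then f (p 0 (last_index hn))
    else if (val i == n - 2)%N && (val j == n - 1)%N
         || (val i == n - 1)%N && (val j == n - 2)%N then 1
    else 0.

(* Main.v *)
(* Write t = x_n for the last coordinate, v' for the part of v in the first n - 2
   coordinates, P for the standard inner product on these coordinates, and e
   for the null vector d/dx_(n-1). With h = f' / (2 f), the Levi-Civita connection is
     Gamma(v, w) = h (v_n w' + w_n v') - f h P(v, w) e,
   whence R = c(t) B with c = f'' / (2 f) - h^2 and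
     B(u, v, w) = w_n (u_n v' - v_n u') - f (u_n P(v, w) - v_n P(u, w)) e.
   The tensor B is parallel, so nabla_X R = X_n c'(t) B is proportional
   to R wherever c(t) <> 0, while R = 0 wherever c(t) = 0. *)

Require Import Defs.
From mathcomp Require Import all_boot all_order all_algebra.
From mathcomp Require Import all_classical all_reals all_analysis.
From mathcomp Require Import perm ring zify.

Import Order.TTheory GRing.Theory Num.Theory.
Import numFieldNormedType.Exports.

Set Implicit Arguments.
Unset Strict Implicit.
Unset Printing Implicit Defensive.

Local Open Scope ring_scope.
Local Open Scope classical_set_scope.

(** * Directional derivatives of functions of a single coordinate *)

Lemma is_derive_scalel (R : realType) (V W : normedModType R) (k : V -> R)
    (A : W) (p v : V) (dk : R) :
  is_derive p v k dk -> is_derive p v (fun q => k q *: A) (dk *: A).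
Proof.
case=> kd <-.
have kA : (fun h : R => h^-1 *: (((fun q => k q *: A) \o shift p) (h *: v)
    - k p *: A)) @ 0^' --> 'D_v k p *: A.
  under eq_fun do rewrite /= -scalerBl scalerA.
  exact: cvgZr_tmp.
by split; [exact: cvgP kA | exact: cvg_lim kA].
Qed.

(** Along [v] the N-th coordinate moves at speed [v 0 N], so the difference quotient is the one of
    [phi] in the direction of the scalar [v 0 N]. *)
Lemma is_derive_coord (R : realType) (n : nat) (N : 'I_n) (phi : R -> R)
    (p v : 'rV[R]_n) (d : R) :
  is_derive (p 0 N) 1 phi d ->
  is_derive p v (fun q => phi (q 0 N)) (v 0 N * d).
Proof.
case; set t := p 0 N => /derivable1_diffP phid <-.
have E : (fun h : R => h^-1 *: (((fun q : 'rV[R]_n => phi (q 0 N)) \o shift p)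
    (h *: v) - phi t)) =
  (fun h : R => h^-1 *: ((phi \o shift t) (h *: v 0 N) - phi t)).
  by apply: funext => h /=; rewrite !mxE.
(* Linearity of the differential of [phi] also covers [v 0 N = 0], where no rescaling of the
   increment is possible. *)
have D : 'D_(v 0 N) phi t = v 0 N * 'D_1 phi t.
  rewrite !deriveE //.
  by rewrite -[v 0 N in LHS]mulr1 -[_ * 1]/(_ *: 1) linearZ.
split; first by rewrite /derivable E; exact: diff_derivable.
by rewrite /derive E -D.
Qed.

Section EgorovSpace.
Context (R : realType) (n : nat) (hn : (3 <= n)%N) (f : R -> R).
Context (f_pos : forall t : R, 0 < f t) (f_smooth : smooth f).

Local Notation vec := 'rV[R]_n.
Local Notation g := (egorov_metric hn f).
Local Notation N := (last_index hn).

(** * Index cases, the metric and its inverse *)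

Fact penultimate_subproof : (n - 2 < n)%N.
Proof. lia. Qed.

Definition penultimate : 'I_n := Ordinal penultimate_subproof.
Local Notation M := penultimate.

(** The part v' is kept inside R^n, padded with zeros, so that it can be added to multiples of the
    null vector. *)
Definition flat (v : vec) : vec :=
  \row_(k < n) if (k < n - 2)%N then v 0 k else 0.

Definition flat_dot (v w : vec) : R :=
  \sum_(k < n | (k < n - 2)%N) v 0 k * w 0 k.

Definition null_vector : vec := delta_mx 0 M.

Local Notation P := flat_dot.
Local Notation eM := null_vector.

Variant index_spec (i : 'I_n) : bool -> bool -> bool -> Type :=
| IndexFlat of (i < n - 2)%N : index_spec i true false false
| IndexPenultimate of i = M : index_spec i false true false
| IndexLast of i = N : index_spec i false false true.

Lemma indexP (i : 'I_n) : index_spec i (i < n - 2)%N (i == M) (i == N).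
Proof.
case: (ltnP i (n - 2)) => hi.
  have -> : (i == M) = false by apply/eqP => /(congr1 val) /=; lia.
  have -> : (i == N) = false by apply/eqP => /(congr1 val) /=; lia.
  by constructor.
case: (eqVneq i M) => [-> | iM].
  have -> : (M == N) = false by apply/eqP => /(congr1 val) /=; lia.
  by constructor.
have -> : i = N.
  apply: val_inj => /=; have := ltn_ord i.
  by move: iM; rewrite -val_eqE /=; lia.
by rewrite eqxx; constructor.
Qed.

Lemma ltN : (N < n - 2)%N = false. Proof. rewrite /=; lia. Qed.
Lemma ltM : (M < n - 2)%N = false. Proof. rewrite /=; lia. Qed.
Lemma eqMN : (M == N) = false.
Proof. by apply/eqP => /(congr1 val) /=; lia. Qed.
Lemma eqNM : (N == M) = false. Proof. by rewrite eq_sym eqMN. Qed.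

(* The position of the only nonzero entry in each row of the metric. *)
Definition swap_null : 'I_n -> 'I_n := tperm M N.
Local Notation s := swap_null.

Lemma egorov_metricE (p : vec) i j :
  g p i j = if j == s i then (if (i < n - 2)%N then f (p 0 N) else 1) else 0.
Proof.
rewrite mxE /s.
have vM k : (val k == n - 2)%N = (k == M) by rewrite -val_eqE.
have vN k : (val k == n - 1)%N = (k == N).
  by rewrite -val_eqE /= subn1.
rewrite !vM !vN; case: (indexP i) => [hi | -> | ->] //=.
- rewrite tpermD ?andbT; last 2 first.
  + by apply/eqP => E; move: hi; rewrite -E ltM.
  + by apply/eqP => E; move: hi; rewrite -E ltN.
  by rewrite eq_sym.
- by rewrite andbF tpermL /= orbF.
- by rewrite andbF tpermR /=.
Qed.

Lemma swap_flat (i : 'I_n) : (i < n - 2)%N -> s i = i.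
Proof.
move=> hi; rewrite /s tpermD//.
  by apply/eqP => E; move: hi; rewrite -E ltM.
by apply/eqP => E; move: hi; rewrite -E ltN.
Qed.

Lemma swapM : s M = N. Proof. exact: tpermL. Qed.
Lemma swapN : s N = M. Proof. exact: tpermR. Qed.

(** Row i of the metric has its only nonzero entry at [s i], and [s] is an involution; hence
    inverting the entries in place gives the inverse matrix. *)
Lemma invmx_egorov_metric (p : vec) k l : invmx (g p) k l =
  if l == s k then (if (k < n - 2)%N then (f (p 0 N))^-1 else 1) else 0.
Proof.
set B : 'M[R]_n := \matrix_(k, l)
  if l == s k then (if (k < n - 2)%N then (f (p 0 N))^-1 else 1) else 0.
have gB : g p *m B = 1%:M.
  apply/matrixP => i j; rewrite !mxE (bigD1 (s i)) //= big1 ?addr0; last first.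
    by move=> m mi; rewrite egorov_metricE (negbTE mi) mul0r.
  rewrite egorov_metricE eqxx mxE /s tpermK eq_sym.
  case: (eqVneq i j) => _; last by rewrite mulr0.
  case: (indexP i) => [hi | -> | ->].
  - by rewrite -/(s i) swap_flat // hi mulfV // gt_eqF.
  - by rewrite -/(s M) swapM ltN mulr1.
  - by rewrite -/(s N) swapN ltM mulr1.
have [gu _] := mulmx1_unit gB.
have -> : invmx (g p) = B by rewrite -[LHS]mulmx1 -gB mulKmx.
by rewrite mxE.
Qed.

(** * Christoffel symbols and the Levi-Civita connection *)

Local Notation f1 := (derive1 f).

Lemma is_derive_f (t : R) : is_derive t 1 f (f1 t).
Proof. by rewrite derive1E; apply: derivableP; exact: (@f_smooth 0%N). Qed.

Lemma partial_egorov_metric (p : vec) (i j l : 'I_n) :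
  partial i (fun q => g q j l) p =
  if [&& i == N, j == l & (j < n - 2)%N] then f1 (p 0 N) else 0.
Proof.
rewrite /partial; case: (boolP ((j < n - 2)%N && (j == l))).
  move=> /andP[hj /eqP <-].
  have -> : (fun q => g q j j) = (fun q => f (q 0 N)).
    by apply: funext => q; rewrite egorov_metricE swap_flat // eqxx hj.
  have Df := is_derive_coord (delta_mx 0 i) (is_derive_f (p 0 N)).
  rewrite (derive_val (is_derive := Df)).
  rewrite mxE !eqxx hj andbT /= eq_sym.
  by case: eqP => _; rewrite ?mul1r ?mul0r.
move=> jl.
have -> : [&& i == N, j == l & (j < n - 2)%N] = false.
  by rewrite [(j == l) && _]andbC (negbTE jl) andbF.
have -> : (fun q => g q j l) = cst (if l == s j then 1 else 0).
  apply: funext => q; rewrite egorov_metricE /=; case: eqP => // E.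
  case: ifPn => // hj; move: jl; rewrite hj E /=.
  by rewrite swap_flat // eqxx.
exact: derive_cst.
Qed.

(** Only l = [s k] survives in the sum. For k = N this is l = M: row M of the metric is constant and
    nothing depends on x_(n-1), so the symbol vanishes. For k = M only the term - d_n g_ij
    remains. *)
Lemma christoffel_egorov (p : vec) (k i j : 'I_n) :
  christoffel g k i j p =
  (if (k < n - 2)%N then
     f1 (p 0 N) / (2 * f (p 0 N)) *
       ((i == N)%:R * (j == k)%:R + (j == N)%:R * (i == k)%:R)
   else 0)
  - (k == M)%:R * (f1 (p 0 N) / 2) * ((i < n - 2)%N && (i == j))%:R.
Proof.
have f0 : f (p 0 N) != 0 by rewrite gt_eqF.
rewrite /christoffel (bigD1 (s k)) //= big1 ?addr0; last first.
  by move=> l lk; rewrite invmx_egorov_metric (negbTE lk) mul0r.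
rewrite invmx_egorov_metric eqxx !partial_egorov_metric.
case: (indexP k) => [hk | -> | ->]; rewrite ?swapM ?swapN ?(swap_flat hk).
- have -> : (k == N) = false by case: (indexP k) hk.
  have E (a b : 'I_n) :
      [&& a == N, b == k & (b < n - 2)%N] = (a == N) && (b == k).
    by case: (eqVneq b k) => [->|]; rewrite ?hk ?andbF.
  rewrite !E /= mul0r !subr0.
  by case: (i == N); case: (j == k); case: (j == N); case: (i == k);
    rewrite /=; field.
- have E (a b : 'I_n) : [&& a == N, b == N & (b < n - 2)%N] = false.
    by case: (eqVneq b N) => [->|]; rewrite ?ltN ?andbF.
  rewrite !E eqxx /= [(i == j) && _]andbC.
  by case: (_ && _); rewrite /=; field.
- rewrite eqMN /=.
  have E (a b : 'I_n) : [&& a == N, b == M & (b < n - 2)%N] = false.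
    by case: (eqVneq b M) => [->|]; rewrite ?ltM ?andbF.
  by rewrite !E; field.
Qed.

(* Gamma is [christoffel_form a b] with a = f' / (2 f) and b = f' / 2; keeping
   the two coefficients independent makes the t-derivative of Gamma again
   such a form. *)
Definition christoffel_form (a b : R) (v w : vec) : vec :=
  a *: (v 0 N *: flat w + w 0 N *: flat v) + b *: (- P v w *: eM).

Lemma covder_egorov (v : vec) (Y : vfield R n) (p : vec) :
  covder g v Y p = 'D_v Y p +
    christoffel_form (f1 (p 0 N) / (2 * f (p 0 N))) (f1 (p 0 N) / 2) v (Y p).
Proof.
rewrite /covder; congr (_ + _); apply/rowP => k; rewrite !mxE.
under eq_bigr do under eq_bigr do rewrite christoffel_egorov.
set a := _ / (2 * _); set b := _ / 2; set w := Y p.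
have S1 (x y : 'I_n) (v1 v2 : vec) : \sum_(i < n) \sum_(j < n)
    (i == x)%:R * (j == y)%:R * (v1 0 i * v2 0 j) = v1 0 x * v2 0 y.
  rewrite (bigD1 x) //= [X in _ + X]big1 ?addr0; last first.
    by move=> i /negbTE ->; apply: big1 => j _; rewrite !mul0r.
  rewrite (bigD1 y) //= big1 ?addr0; last first.
    by move=> j /negbTE ->; rewrite mulr0 mul0r.
  by rewrite !eqxx !mul1r.
have S2 : \sum_(i < n) \sum_(j < n) ((i < n - 2)%N && (i == j))%:R *
    (v 0 i * w 0 j) = P v w.
  rewrite /P [RHS]big_mkcond /=; apply: eq_bigr => i _.
  rewrite (bigD1 i) //= big1 ?addr0; last first.
    by move=> j ji; rewrite eq_sym (negbTE ji) andbF mul0r.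
  by rewrite eqxx andbT; case: ifP => _; rewrite ?mul1r ?mul0r.
(* Separate the two products of Kronecker deltas, evaluated by [S1], from the diagonal sum, which
   [S2] identifies with P. *)
transitivity ((if (k < n - 2)%N then a else 0) *
    (\sum_(i < n) \sum_(j < n) (i == N)%:R * (j == k)%:R * (v 0 i * w 0 j) +
     \sum_(i < n) \sum_(j < n) (i == k)%:R * (j == N)%:R * (v 0 i * w 0 j))
   - (k == M)%:R * b * \sum_(i < n) \sum_(j < n)
       ((i < n - 2)%N && (i == j))%:R * (v 0 i * w 0 j)).
  rewrite -big_split /= !mulr_sumr -sumrN -big_split /=; apply: eq_bigr => i _.
  rewrite -big_split /= !mulr_sumr -sumrN -big_split /=; apply: eq_bigr => j _.
  by case: ifP => _; ring.
rewrite !S1 S2 eqxx /=.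
by case: ifP => _; ring.
Qed.

(** * Algebra of flat parts and of nested connection terms *)

Lemma flatD v w : flat (v + w) = flat v + flat w.
Proof.
by apply/rowP => k; rewrite !mxE; case: ifP => _; rewrite ?addr0.
Qed.

Lemma flatZ a v : flat (a *: v) = a *: flat v.
Proof. by apply/rowP => k; rewrite !mxE; case: ifP => _; rewrite ?mulr0. Qed.

Lemma flatK v : flat (flat v) = flat v.
Proof. by apply/rowP => k; rewrite !mxE; case: ifP => // ->. Qed.

Lemma flat_null : flat eM = 0.
Proof.
apply/rowP => k; rewrite !mxE eqxx /=.
by case: (indexP k).
Qed.

Lemma flat_dotC v w : P v w = P w v.
Proof. by apply: eq_bigr => k _; rewrite mulrC. Qed.

Lemma flat_dotDl u v w : P (u + v) w = P u w + P v w.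
Proof. by rewrite -big_split; apply: eq_bigr => k _; rewrite mxE mulrDl. Qed.

Lemma flat_dotZl a v w : P (a *: v) w = a * P v w.
Proof. by rewrite mulr_sumr; apply: eq_bigr => k _; rewrite mxE mulrA. Qed.

Lemma flat_dot_flatl v w : P (flat v) w = P v w.
Proof. by apply: eq_bigr => k hk; rewrite mxE hk. Qed.

Lemma flat_dot_nulll w : P eM w = 0.
Proof.
apply: big1 => k hk; rewrite mxE eqxx /=.
by move: hk; case: (indexP k) => // _ _; rewrite mul0r.
Qed.

Lemma flat_christoffel a b v w : flat (christoffel_form a b v w) =
  a *: (v 0 N *: flat w + w 0 N *: flat v).
Proof. by rewrite !(flatD, flatZ, flatK, flat_null) !scaler0 addr0. Qed.

(** This expresses that dx_n is parallel. *)
Lemma christoffel_last a b v w : christoffel_form a b v w 0 N = 0.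
Proof.
by rewrite !mxE ltN eqNM !mulr0 !addr0 mulr0.
Qed.

Lemma flat_dot_christoffel a b v w z : P (christoffel_form a b v w) z =
  a * (v 0 N * P w z + w 0 N * P v z).
Proof.
rewrite !(flat_dotDl, flat_dotZl, flat_dot_flatl, flat_dot_nulll).
by rewrite !mulr0 addr0.
Qed.

(** The inner value has last coordinate 0, and its null component is invisible to [flat] and P. Only
    its flat part contributes, so [d] drops out. *)
Lemma christoffel_form_comp a b c d u v w :
  christoffel_form a b u (christoffel_form c d v w) =
  (a * c * u 0 N) *: (v 0 N *: flat w + w 0 N *: flat v) +
  (- (b * c) * (v 0 N * P u w + w 0 N * P u v)) *: eM.
Proof.
rewrite {1}/christoffel_form flat_christoffel christoffel_last.
rewrite flat_dotC flat_dot_christoffel (flat_dotC v u) (flat_dotC w u).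
by apply/rowP => k; rewrite !mxE; ring.
Qed.

(** For fixed arguments both Gamma(y, z) and R(u, v)w are combinations of two constant vectors with
    coefficients depending on x_n alone. *)
Lemma derive_last_coord_comb (a b : R -> R) (da db : R) (A B p v : vec) :
  is_derive (p 0 N) 1 a da -> is_derive (p 0 N) 1 b db ->
  'D_v (fun q : vec => a (q 0 N) *: A + b (q 0 N) *: B) p =
  v 0 N *: (da *: A + db *: B).
Proof.
move=> /(is_derive_coord v)/(is_derive_scalel A) Da.
move=> /(is_derive_coord v)/(is_derive_scalel B) Db.
by rewrite (derive_val (is_derive := is_deriveD Da Db)) scalerDr !scalerA.
Qed.

(** * The curvature tensor and its covariant derivative *)

Local Notation f2 := (derive1 f1).
Local Notation f3 := (derive1 f2).

Definition conn_coef (t : R) : R := f1 t / (2 * f t).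

Definition curv_coef (t : R) : R := f2 t / (2 * f t) - conn_coef t ^+ 2.

(* R is [curvature_form c (c * f)], and the parallel tensor B is
   [curvature_form 1 f]. *)
Definition curvature_form (a b : R) (u v w : vec) : vec :=
  a *: (w 0 N *: (u 0 N *: flat v - v 0 N *: flat u)) +
  b *: ((v 0 N * P u w - u 0 N * P v w) *: eM).

(** This is the connection term in the derivative of R(u, v)w. As for nested Gammas, only the flat
    part of the inner value counts, so [d] drops out. *)
Lemma christoffel_curvature_form a b c d x u v w :
  christoffel_form a b x (curvature_form c d u v w) =
  (a * c * x 0 N * w 0 N) *: (u 0 N *: flat v - v 0 N *: flat u) +
  (- (b * c) * w 0 N * (u 0 N * P x v - v 0 N * P x u)) *: eM.
Proof.
rewrite /christoffel_form flat_dotC.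
have -> : curvature_form c d u v w 0 N = 0.
  by rewrite !mxE ltN eqNM !(mulr0, oppr0, addr0).
rewrite /curvature_form -scaleNr.
rewrite !(flatD, flatZ, flatK, flat_null).
rewrite !(flat_dotDl, flat_dotZl, flat_dot_flatl, flat_dot_nulll).
rewrite (flat_dotC v x) (flat_dotC u x).
by apply/rowP => k; rewrite !mxE; ring.
Qed.

Lemma is_derive_f1 (t : R) : is_derive t 1 f1 (f2 t).
Proof. by rewrite derive1E; apply: derivableP; exact: (@f_smooth 1%N). Qed.

Lemma is_derive_f2 (t : R) : is_derive t 1 f2 (f3 t).
Proof. by rewrite derive1E; apply: derivableP; exact: (@f_smooth 2%N). Qed.

Lemma is_derive_div_2f (k : R -> R) (t dk : R) : is_derive t 1 k dk ->
  is_derive t 1 (fun x => k x / (2 * f x))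
    (dk / (2 * f t) - k t * f1 t / (2 * f t ^+ 2)).
Proof.
move=> Dk; have f0 : f t != 0 by rewrite gt_eqF.
have Df2 := @is_deriveZ _ _ _ f 2 t 1 _ (is_derive_f t).
have f20 : (2 \*: f) t != 0 by rewrite /= scaler_eq0 negb_or f0 pnatr_eq0.
apply: (is_derive_eq (is_deriveM Dk (is_deriveV f20 Df2))).
rewrite /= -![_ *: _]/(_ * _).
by field.
Qed.

(** From f'' / (2 f) = c + h^2 and f'^2 / (2 f^2) = 2 h^2 one gets h' = c - h^2. *)
Lemma is_derive_conn_coef (t : R) :
  is_derive t 1 conn_coef (curv_coef t - conn_coef t ^+ 2).
Proof.
have f0 : f t != 0 by rewrite gt_eqF.
apply: (is_derive_eq (is_derive_div_2f (is_derive_f1 t))).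
by rewrite /curv_coef /conn_coef; field.
Qed.

Lemma is_derive_half_f1 (t : R) : is_derive t 1 (fun x => f1 x / 2) (f2 t / 2).
Proof.
have -> : (fun x => f1 x / 2) = (2^-1 \*: f1).
  by apply: funext => x; rewrite mulrC.
apply: (is_derive_eq (is_deriveZ _ (is_derive_f1 t))).
by rewrite mulrC.
Qed.

(** The value of c' stays implicit, since nabla R is a multiple of B whatever it is; existence rests
    on the third derivative of f. *)
Lemma ex_derive_curv_coef (t : R) : {d | is_derive t 1 curv_coef d}.
Proof.
have D1 := is_derive_div_2f (is_derive_f2 t).
have D2 := is_derive_conn_coef t.
have D3 := is_deriveM D2 D2.
by eexists; apply: (is_deriveB D1 D3).
Qed.

Lemma curvature_egorov (p u v w : vec) : curvature g p u v w =
  curvature_form (curv_coef (p 0 N)) (curv_coef (p 0 N) * f (p 0 N)) u v w.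
Proof.
rewrite /curvature /curvature_op.
have constE (y z q : vec) : nabla g (fun=> y) (fun=> z) q =
    christoffel_form (conn_coef (q 0 N)) (f1 (q 0 N) / 2) y z.
  by rewrite /nabla covder_egorov derive_cst add0r.
have D (x y z : vec) : nabla g (fun=> x) (nabla g (fun=> y) (fun=> z)) p =
    x 0 N *: christoffel_form (curv_coef (p 0 N) - conn_coef (p 0 N) ^+ 2)
      (f2 (p 0 N) / 2) y z +
    christoffel_form (conn_coef (p 0 N)) (f1 (p 0 N) / 2) x
     (christoffel_form (conn_coef (p 0 N)) (f1 (p 0 N) / 2) y z).
  rewrite {1}/nabla covder_egorov constE; congr (_ + _).
  rewrite (funext (constE y z)) /christoffel_form.
  apply: (derive_last_coord_comb (a := conn_coef) (b := fun t => f1 t / 2)).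
    exact: is_derive_conn_coef.
  exact: is_derive_half_f1.
rewrite !D.
(* Constant fields commute. The zero vector is then written as [0 *: u], so that homogeneity of
   [flat] and P applies. *)
have -> : nabla g (lie_bracket (fun=> u) (fun=> v)) (fun=> w) p = 0.
  rewrite /nabla /lie_bracket !derive_cst subr0 covder_egorov derive_cst add0r.
  apply/rowP => k; rewrite /christoffel_form.
  by rewrite -(scale0r u) flatZ flat_dotZl !(mxE, mul0r, mulr0, add0r, oppr0).
rewrite subr0.
have f0 : f (p 0 N) != 0 by rewrite gt_eqF.
(* Expressing f' and f'' through f, h and c lets these three be treated as independent variables,
   and the claim becomes a polynomial identity in each coordinate. *)
have E1 : f1 (p 0 N) = 2 * conn_coef (p 0 N) * f (p 0 N).
  by rewrite /conn_coef; field.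
have E2 : f2 (p 0 N) =
    2 * (curv_coef (p 0 N) + conn_coef (p 0 N) ^+ 2) * f (p 0 N).
  by rewrite /curv_coef /conn_coef; field.
rewrite E1 E2; move: (f _) (conn_coef _) (curv_coef _) => F h c.
rewrite !christoffel_form_comp (flat_dotC v u).
rewrite /christoffel_form /curvature_form.
move: (flat u) (flat v) (flat w) (P _ _) (P _ _) (P _ _) => u' v' w' x y z.
move: eM (u 0 N) (v 0 N) (w 0 N) => e uN vN wN.
by apply/rowP => k; rewrite !mxE; field.
Qed.

(** Differentiating the coefficients c and c f yields x_n c' B plus x_n c f' on the null term. As f'
    = 2 h f, this extra term and the connection terms sum to zero, which is the parallelism of B. *)
Lemma covder_curvature_egorov (p x u v w : vec) (d : R) :
  is_derive (p 0 N) 1 curv_coef d ->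
  covder_tensor g (curvature g) x p u v w =
  (x 0 N * d) *: curvature_form 1 (f (p 0 N)) u v w.
Proof.
move=> Dc; rewrite /covder_tensor !curvature_egorov.
rewrite !covder_egorov !derive_cst !add0r.
have -> : (fun q => curvature g q u v w) = (fun q => curvature_form
    (curv_coef (q 0 N)) (curv_coef (q 0 N) * f (q 0 N)) u v w).
  by apply: funext => q; exact: curvature_egorov.
have Dcf := is_deriveM Dc (is_derive_f (p 0 N)).
rewrite (derive_last_coord_comb _ _ _ Dc Dcf) curvature_egorov.
have f0 : f (p 0 N) != 0 by rewrite gt_eqF.
rewrite -/(conn_coef (p 0 N)).
have E1 : f1 (p 0 N) = 2 * conn_coef (p 0 N) * f (p 0 N).
  by rewrite /conn_coef; field.
(* The product rule is stated with scaling of the field on itself; it is turned back into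
   multiplication for [field]. *)
rewrite E1 -![curv_coef _ *: _]/(_ * _) -![f _ *: _]/(_ * _).
move: (f _) (conn_coef _) (curv_coef _) => F h c.
rewrite christoffel_curvature_form.
rewrite /curvature_form !flat_christoffel !christoffel_last.
rewrite (flat_dotC v (christoffel_form _ _ _ _)).
rewrite (flat_dotC u (christoffel_form _ _ _ _)).
rewrite !flat_dot_christoffel.
rewrite (flat_dotC w u) (flat_dotC w v).
apply/rowP => k; rewrite !mxE.
by field.
Qed.

End EgorovSpace.

(** * Linear dependence of nabla R and R at each point *)

Theorem theorem9 (R : realType) (n : nat) (hn : (3 <= n)%N) (f : R -> R)
    (f_pos : forall t : R, 0 < f t) (f_smooth : smooth f) :
  recurrent_curvature (egorov_metric hn f).
Proof.
move=> p x; set t := p 0 (last_index hn).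
have [d Dc] := ex_derive_curv_coef f_pos f_smooth t.
have RE := curvature_egorov hn f_pos f_smooth p.
have DE u v w := covder_curvature_egorov f_pos f_smooth x u v w Dc.
have [c0 | c0] := eqVneq (curv_coef f t) 0.
  (* Here R = c B = 0 at p, so R alone gives a nontrivial relation. *)
  exists 0, 1; split; first by case=> _ /eqP; rewrite oner_eq0.
  move=> u v w; rewrite RE -/t c0 mul0r /curvature_form.
  by rewrite !(scale0r, scaler0, addr0).
(* With R = c B and nabla_x R = x_n c' B, the combination c nabla_x R - x_n c' R vanishes, and it is
   nontrivial because c is nonzero. *)
exists (curv_coef f t), (- (x 0 (last_index hn) * d)).
split; first by case=> c0'; rewrite c0' eqxx in c0.
move=> u v w; rewrite RE DE -/t /curvature_form.
by apply/rowP => k; rewrite !mxE; ring.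
Qed.
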